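(* Let $q$ and $q_0$ be odd prime powers and let $k\ge 1$. Let $1=s_0<s_1<\dots<s_k$ be integers such that $$\mathbb{F}_{q_0}=\mathbb{F}_{q_0^{s_0}}\subsetneq\mathbb{F}_{q_0^{s_1}}\subsetneq\dots\subsetneq\mathbb{F}_{q_0^{s_k}}=\mathbb{F}_q$$ is a chain of subfields. Let $\{\alpha_1,\dots,\alpha_n\}$ be a subgroup of $\mathbb{F}_{q_0}^*$ of order $n$, and put $\bm\alpha=(\alpha_1,\dots,\alpha_n)$. Let $\eta_i\in\mathbb{F}_{q_0^{s_i}}\setminus\mathbb{F}_{q_0^{s_{i-1}}}$ for $i=1,\dots,k$, with $1+\eta_1^2\ne0$ and $\eta_i\neq0$ for $i=2,\dots,k$. Let $\bm t=(1,2,\dots,k)$, $\bm h=(0,1,\dots,k-1)$, $\bm\eta=(\eta_1,\dots,\eta_k)\in(\mathbb{F}_q^* )^k$, and let $k\le\frac n2$. If $k,n$ satisfy one of the following conditions: (A) $k\ge3$ and $k=\frac{n+1}{3}$; (B) $k\ge3$ and $k=\frac n3$; (C) $k\ge3$ and $\frac{n+2}{3}\le k<\frac n2$; (D) $k\ge3$ and $k=\frac n2$; (E) $k=1$ and $n>2$; then the twisted Reed-Solomon code $TRS_{k,n}[\bm\alpha,\bm t,\bm h,\bm\eta]$ over $\mathbb{F}_q$ is an LCD MDS code.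
   Context: For distinct $\alpha_1,\dots,\alpha_n\in\mathbb{F}_q$ and $\bm t=(1,2,\dots,k)$, $\bm h=(0,1,\dots,k-1)$, $\bm\eta\in(\mathbb{F}_q^* )^k$, the twisted Reed-Solomon code is $$TRS_{k,n}[\bm\alpha,\bm t,\bm h,\bm\eta]=\Big\{(f(\alpha_1),\dots,f(\alpha_n)) : f=\sum_{i=0}^{k-1}f_ix^i+\sum_{j=1}^{k}\eta_jf_{j-1}x^{k-1+j},\ f_0,\dots,f_{k-1}\in\mathbb{F}_q\Big\}\subseteq\mathbb{F}_q^n.$$ A linear code of length $n$, dimension $k$ and minimum Hamming distance $d$ is MDS if $d=n-k+1$; here ''MDS'' means an MDS code of length $n$ and dimension $k$. A linear code $C\subseteq\mathbb{F}_q^n$ is LCD (linear complementary dual) if $C\cap C^\perp=\{0\}$, where $C^\perp$ is the dual with respect to the Euclidean inner product. *)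

(* Defs.v *)
From HB Require Import structures.
From mathcomp Require Import all_boot all_order all_algebra all_fingroup all_field.

Set Implicit Arguments.
Unset Strict Implicit.
Unset Printing Implicit Defensive.

Import GRing.Theory.
Local Open Scope ring_scope.

Definition odd_prime_power (q : nat) : Prop :=
  odd q /\ exists p m : nat, [/\ prime p, (0 < m)%N & q = (p ^ m)%N].

Section LinearCodes.

Variables (F : finFieldType) (n : nat).

Definition hamming_dist (x y : 'rV[F]_n) : nat := #|[set i | x 0 i != y 0 i]|.

Definition has_min_dist (C : {vspace 'rV[F]_n}) (d : nat) : Prop :=
  (exists x y, [/\ x \in C, y \in C, x != y & hamming_dist x y = d]) /\
  (forall x y, x \in C -> y \in C -> x != y -> (d <= hamming_dist x y)%N).

(* The truncated subtraction is harmless: [\dim C = k] forces [k <= n]. *)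
Definition is_MDS (k : nat) (C : {vspace 'rV[F]_n}) : Prop :=
  \dim C = k /\ has_min_dist C (n - k + 1).

Definition dotp (x y : 'rV[F]_n) : F := \sum_i x 0 i * y 0 i.

Definition dual_code (C : {vspace 'rV[F]_n}) : {set 'rV[F]_n} :=
  [set x | [forall y in C, dotp x y == 0]].

Definition is_LCD (C : {vspace 'rV[F]_n}) : Prop :=
  [set x in C] :&: dual_code C = [set 0].

End LinearCodes.

Section TwistedReedSolomon.

Variables (F : finFieldType) (k n l : nat).
Variables (alpha : 'I_n -> F) (t : 'I_l -> nat) (h : 'I_l -> 'I_k).
Variable eta : 'I_l -> F.

(* Twists are numbered from 0: [t j], [h j], [eta j] are t_(j+1), h_(j+1),
   eta_(j+1) in the usual notation. *)
Definition twisted_poly (f : 'rV[F]_k) : {poly F} :=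
  \sum_(i < k) f 0 i *: 'X^i + \sum_(j < l) (eta j * f 0 (h j)) *: 'X^(k - 1 + t j).

Definition trs_word (f : 'rV[F]_k) : 'rV[F]_n :=
  \row_i (twisted_poly f).[alpha i].

Fact trs_word_is_linear : linear trs_word.
Proof.
move=> a u v; apply/rowP => i; rewrite !mxE -hornerZ -hornerD; congr _.[_].
rewrite /twisted_poly scalerDr addrACA !scaler_sumr -!big_split /=.
congr (_ + _); apply: eq_bigr => j _; rewrite !mxE scalerA -scalerDl //.
by rewrite mulrDr mulrCA.
Qed.

HB.instance Definition _ :=
  GRing.isLinear.Build F 'rV[F]_k 'rV[F]_n _ trs_word trs_word_is_linear.

Definition TRS : {vspace 'rV[F]_n} := limg (linfun trs_word).

Lemma TRSP (c : 'rV[F]_n) : reflect (exists f, c = trs_word f) (c \in TRS).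
Proof.
apply: (iffP memv_imgP) => [[f _ ->]|[f ->]]; exists f; rewrite ?lfunE //.
exact: memvf.
Qed.

End TwistedReedSolomon.

(* Main.v *)
(** The code is spanned by the evaluations of the g_i = X^i + eta_i X^(k+i),
    0 <= i < k. MDS: at k distinct points of the small field, adjoining the
    twists one row at a time to a Vandermonde matrix never kills the
    determinant, since eta_i lies outside the field generated so far; so a
    nonzero codeword has fewer than k zeros. LCD: the m-th power sum over a
    subgroup of order n of the units is n or 0 according to whether n divides m,
    so the Gram matrix of the g_i is supported on the three antidiagonals
    i + j = 0, n - k, n - 2k, with entries 1, eta_i + eta_j, eta_i eta_j up to
    the factor n, and one reads off that it is nonsingular. *)
Require Import Defs.
From HB Require Import structures.
From mathcomp Require Import all_boot all_order all_algebra all_fingroup all_field.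
From mathcomp Require Import cyclic.
From mathcomp Require Import zify ring.

Set Implicit Arguments.
Unset Strict Implicit.
Unset Printing Implicit Defensive.

Import GRing.Theory.
Local Open Scope ring_scope.

(** * Determinants over subrings closed under division *)

Section DeterminantInSubring.

Variables (F : comUnitRingType) (S : {pred F}).
Hypothesis divringS : divring_closed S.
HB.instance Definition _ := GRing.isDivringClosed.Build F S divringS.

(** The fields of the chain are bare sets with a closure hypothesis; the lemmas of this section make
    [rpred] arguments available for them. *)
Lemma det_divring_closed m (M : 'M[F]_m) :
  (forall i j, M i j \in S) -> \det M \in S.
Proof.
move=> MS; apply: rpred_sum => s _; apply: rpredM; first by rewrite rpredX ?rpredN1.
exact: rpred_prod.
Qed.

Lemma divring_closedX x m : x \in S -> x ^+ m \in S.
Proof. exact: rpredX. Qed.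

Lemma divring_closedDM x y z : x \in S -> y \in S -> z \in S -> x + y * z \in S.
Proof. by move=> xS yS zS; rewrite rpredD ?rpredM. Qed.

Lemma divring_closedN_div x y : x \in S -> y \in S -> - (x / y) \in S.
Proof. by move=> xS yS; rewrite rpredN rpred_div. Qed.

End DeterminantInSubring.

(** * Twisted Vandermonde determinants over a chain of subfields *)

Section TwistedDeterminant.

Variables (F : finFieldType) (k : nat) (K : nat -> {set F}) (eta : 'I_k -> F).
Hypothesis Kfield : forall i, (i <= k)%N -> divring_closed (K i).
Hypothesis Kchain : forall i, (i < k)%N -> K i \subset K i.+1.
Hypothesis etaK : forall i : 'I_k, eta i \in K i.+1 :\: K i.

Lemma chain_subset i j : (i <= j <= k)%N -> K i \subset K j.
Proof.
elim: j => [|j IHj] /andP[le_ij le_jk].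
  by move: le_ij; rewrite leqn0 => /eqP->.
move: le_ij; rewrite leq_eqVlt => /orP[/eqP-> //|le_ij].
by apply: subset_trans (IHj _) (Kchain le_jk); rewrite -ltnS le_ij ltnW.
Qed.

(* Twist the rows one at a time: by linearity in row [m], the new determinant
   is [a + eta m * b] with [a != 0], [a] and [b] in [K m], [eta m] not in [K m]. *)
Lemma det_twist_neq0 (V W : 'M[F]_k) :
  (forall i j, V i j \in K 0) -> (forall i j, W i j \in K 0) ->
  \det V != 0 -> \det (\matrix_(i, j) (V i j + eta i * W i j)) != 0.
Proof.
move=> VK WK detV.
pose M m := \matrix_(i, j) (V i j + (if (i < m)%N then eta i * W i j else 0)).
suff detM m : (m <= k)%N -> \det (M m) != 0.
  move: (detM k (leqnn k)); congr (_ != 0); congr (\det _).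
  by apply/matrixP=> i j; rewrite !mxE ltn_ord.
elim: m => [_|m IHm lt_mk].
  by rewrite (_ : M 0%N = V) //; apply/matrixP=> i j; rewrite !mxE addr0.
have K0m x : x \in K 0%N -> x \in K m.
  by apply: (subsetP (chain_subset _)); apply: ltnW.
have Kdiv := Kfield (ltnW lt_mk).
have MK i j : M m i j \in K m.
  rewrite mxE; case: ifP => [lt_im|_]; last by rewrite addr0 K0m.
  apply: divring_closedDM => //; [exact: K0m | | exact: K0m].
  have := etaK i; rewrite inE => /andP[_].
  by apply: (subsetP (chain_subset _)); rewrite lt_im ltnW.
pose i0 := Ordinal lt_mk.
pose N := \matrix_(i, j) (if i == i0 then W i j else M m i j).
have NK i j : N i j \in K m by rewrite mxE; case: ifP => _; [exact: K0m | exact: MK].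
have lift_neq i : (lift i0 i == i0) = false.
  by apply/negbTE; rewrite eq_sym neq_lift.
have -> : \det (M m.+1) = 1 * \det (M m) + eta i0 * \det N.
  apply: (determinant_multilinear (i0 := i0)).
  - apply/rowP=> j; rewrite !mxE ltnn ltnS leqnn eqxx.
    by rewrite addr0 mul1r.
  - apply/matrixP=> i j; rewrite !mxE ltnS [in RHS]leq_eqVlt.
    by rewrite -[X in X || _]/(lift i0 i == i0) lift_neq.
  - apply/matrixP=> i j; rewrite !mxE lift_neq ltnS [in RHS]leq_eqVlt.
    by rewrite -[X in X || _]/(lift i0 i == i0) lift_neq.
have {}IHm := IHm (ltnW lt_mk).
rewrite mul1r; apply: contraL (etaK i0) => /eqP det0; rewrite inE negb_and negbK.
apply/orP; left.
(* With this, a vanishing determinant would express [eta i0] as a quotient of elements of [K m]. *)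
have detN : \det N != 0.
  by apply: contraNneq IHm => N0; rewrite -det0 N0 mulr0 addr0.
have -> : eta i0 = - (\det (M m) / \det N).
  rewrite -mulNr; apply: (canRL (mulfK detN)).
  by apply/eqP; rewrite -addr_eq0 addrC det0.
by apply: divring_closedN_div => //; apply: det_divring_closed.
Qed.

(** Row [i] of the twisted matrix lists the values of X^i + eta_i X^(k+i) at the points [b]. Its
    untwisted part is Vandermonde with distinct nodes, so the matrix is invertible, and [f] lies in
    its left kernel. *)
Lemma twist_vanish (f : 'rV[F]_k) (b : 'I_k -> F) :
    injective b -> (forall i, b i \in K 0) ->
    (forall i, \sum_j f 0 j * (b i ^+ j + eta j * b i ^+ (k + j)) = 0) ->
  f = 0.
Proof.
move=> b_inj bK fb0.
pose V := Vandermonde k (\row_i b i).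
pose W := \matrix_(i < k, j < k) b j ^+ (k + i).
have detVW : \det (\matrix_(i, j) (V i j + eta i * W i j)) != 0.
  apply: det_twist_neq0 => [i j|i j|].
  - by rewrite !mxE divring_closedX //; apply: Kfield.
  - by rewrite !mxE divring_closedX //; apply: Kfield.
  rewrite det_Vandermonde; apply/prodf_neq0 => i _; apply/prodf_neq0 => j lt_ij.
  by rewrite !mxE subr_eq0 (inj_eq b_inj) neq_ltn lt_ij orbT.
have /row_free_inj : row_free (\matrix_(i, j) (V i j + eta i * W i j)).
  by rewrite row_free_unit unitmxE unitfE.
apply; rewrite mul0mx; apply/rowP=> i; rewrite !mxE -[RHS](fb0 i).
by apply: eq_bigr => j _; rewrite !mxE.
Qed.

End TwistedDeterminant.

Lemma trs_wordE (F : finFieldType) k n (alpha : 'I_n -> F) (eta : 'I_k -> F)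
    (f : 'rV[F]_k) l :
  trs_word alpha (fun j : 'I_k => j.+1) id eta f 0 l =
  \sum_j f 0 j * (alpha l ^+ j + eta j * alpha l ^+ (k + j)).
Proof.
rewrite mxE /twisted_poly hornerD !horner_sum -big_split /=.
apply: eq_bigr => j _; rewrite !hornerE.
(* The subtraction is truncated, but an element of ['I_k] makes [k] positive. *)
by have -> : (k - 1 + j.+1 = k + j)%N; [have := ltn_ord j; lia | ring].
Qed.

Lemma natr_card_finField (F : finFieldType) : #|F|%:R = 0 :> F.
Proof. by have := expg_cardG (in_setT (1 : F)); rewrite cardsT FinRing.zmodXgE. Qed.

(** * Power sums over a subgroup of the units *)

Section PowerSums.

Variables (F : finFieldType) (G : {group {unit F}}).

(** By Lagrange [#|G|] divides [#|F|.-1]; if it were 0 in [F], then [#|F|], which is 0 there, would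
    also be 1. *)
Lemma natr_card_unit_subgroup_neq0 : (#|G|%:R : F) != 0.
Proof.
apply/eqP=> G0.
have /dvdnP[m Dm] : (#|G| %| #|F|.-1)%N by rewrite -card_finField_unit cardSg ?subsetT.
have F_gt0 : (0 < #|F|)%N by apply: ltnW; apply: finNzRing_gt1.
move/eqP: (natr_card_finField F); rewrite -(prednK F_gt0) -addn1 natrD Dm natrM G0 mulr0 add0r.
by rewrite oner_eq0.
Qed.

(** Translation by a generator [g] permutes [G] and multiplies the sum by g^m, which differs from 1
    unless [#|G|] divides [m]. *)
Lemma sum_unit_subgroup_expr m :
  \sum_(u in G) (val u : F) ^+ m = if (#|G| %| m)%N then #|G|%:R else 0.
Proof.
have [/dvdnP[e ->]|nGm] := ifPn.
  rewrite (eq_bigr (fun=> 1)) ?sumr_const // => u Gu.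
  by rewrite mulnC exprM -FinRing.val_unitX expg_cardG // FinRing.val_unit1 expr1n.
have /cyclicP[g DG] := field_unit_group_cyclic G.
have Gg : g \in G by rewrite DG cycle_id.
set S := \sum_(u in G) _.
have SgS : val g ^+ m * S = S.
  rewrite [RHS](reindex_inj (mulgI g)) mulr_sumr.
  by apply: eq_big => u; rewrite ?groupMl // => _; rewrite FinRing.val_unitM exprMn.
have : (val g ^+ m - 1) * S = 0 by rewrite mulrBl SgS mul1r subrr.
move/eqP; rewrite mulf_eq0 subr_eq0 => /orP[/eqP gm1|/eqP //].
case/negP: nGm; rewrite DG order_dvdn; apply/eqP/val_inj.
by rewrite /= FinRing.val_unitX gm1.
Qed.

End PowerSums.

(** * An MDS criterion, and inner products of codewords *)

Section Codes.

Variables (F : finFieldType) (k n : nat) (alpha : 'I_n -> F) (eta : 'I_k -> F).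

Local Notation word := (trs_word alpha (fun j : 'I_k => j.+1) (fun j : 'I_k => j) eta).
Local Notation C := (TRS alpha (fun j : 'I_k => j.+1) (fun j : 'I_k => j) eta).

Local Notation zeros f := [set i | word f 0%R i == 0%R].
Local Notation supp f := [set i | word f 0%R i != 0%R].

(** Fewer than [k] zeros per nonzero message gives both the dimension and the lower bound on
    weights. The bound is attained because [k.-1] vanishing conditions on [k] coefficients admit a
    nonzero solution. *)
Lemma is_MDS_twist_vanish :
    (0 < k <= n)%N -> injective alpha ->
    (forall (f : 'rV[F]_k) (b : 'I_k -> F), injective b ->
      (forall i, b i \in codom alpha) ->
      (forall i, \sum_j f 0 j * (b i ^+ j + eta j * b i ^+ (k + j)) = 0) -> f = 0) ->
  is_MDS k C.
Proof.
move=> /andP[k_gt0 le_kn] alpha_inj van.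
have few_zeros f : f != 0 -> (#|zeros f| < k)%N.
  move=> nz_f; rewrite ltnNge; apply: contra nz_f => leZ; apply/eqP.
  (* With at least [k] zeros, the first [k] of them serve as the points [b]. *)
  apply: (van f (fun i => alpha (enum_val (widen_ord leZ i)))).
  - by move=> i j /alpha_inj/enum_val_inj/(congr1 val)/= ij; apply: val_inj.
  - by move=> i; apply: codom_f.
  move=> i; have := enum_valP (widen_ord leZ i).
  by rewrite inE trs_wordE => /eqP.
have wt_lb f : f != 0 -> (n - k + 1 <= #|supp f|)%N.
  move=> /few_zeros; have := cardsC (zeros f).
  rewrite card_ord (_ : ~: _ = supp f); first by lia.
  by apply/setP=> i; rewrite !inE.
have distE (f g : 'rV[F]_k) :
    hamming_dist (word f) (word g) = #|supp (f - g)|.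
  rewrite /hamming_dist; congr #|pred_of_set _|; apply/setP => i.
  by rewrite !inE linearB /= [in RHS]mxE [X in _ + X]mxE subr_eq0.
split.
  rewrite limg_dim_eq ?dimvf; first by rewrite /dim /= mul1n.
  apply/eqP; rewrite capfv -subv0; apply/subvP=> f.
  rewrite memv_ker lfunE /= memv0 => /eqP f0; apply/eqP; apply: contraTeq le_kn => /wt_lb.
  rewrite (_ : [set i | _] = set0) ?cards0; first by rewrite addn1.
  by apply/setP=> i; rewrite !inE f0 mxE eqxx.
split; last first.
  move=> _ _ /TRSP[f ->] /TRSP[g ->] fg; rewrite distE wt_lb // subr_eq0.
  by apply: contraNneq fg => ->.
(* Unit messages evaluated at the first [k.-1] positions: a left kernel vector is a message whose
   word vanishes there. *)
pose A := \matrix_(j < k, l < k.-1)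
  word (delta_mx 0 j) 0 (widen_ord (leq_trans (leq_pred k) le_kn) l).
have /rowV0Pn[f /sub_kermxP fA0 nz_f] : kermx A != 0.
  rewrite kermx_eq0 -row_leq_rank -ltnNge (leq_ltn_trans (rank_leq_col A)) //.
  by rewrite ltn_predL.
exists (word f), (word 0); split; try by apply/TRSP; eexists.
  apply: contraNneq (nz_f) => fg.
  have := wt_lb f nz_f; rewrite -[f in word f]subr0 -distE fg /hamming_dist.
  rewrite (_ : [set i | _] = set0) ?cards0 ?addn1 //.
  by apply/setP=> i; rewrite !inE eqxx.
apply/eqP; rewrite distE subr0 eqn_leq wt_lb // andbT.
have := cardsC (zeros f); rewrite card_ord.
rewrite (_ : ~: _ = supp f); last first.
  by apply/setP=> i; rewrite !inE.
suff : (k.-1 <= #|zeros f|)%N by lia.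
pose w l := widen_ord (leq_trans (leq_pred k) le_kn) l.
have w_inj : injective w by move=> l m /(congr1 val)/= lm; apply: val_inj.
rewrite -[X in (X <= _)%N]card_ord -(card_codom w_inj).
apply/subset_leq_card/subsetP=> _ /codomP[l ->].
rewrite inE; apply/eqP; have /rowP/(_ l) := fA0; rewrite [RHS]mxE => <-.
rewrite {1}(row_sum_delta f) linear_sum summxE [RHS]mxE.
by apply: eq_bigr => j _; rewrite linearZ [LHS]mxE; congr (_ * _); rewrite [RHS]mxE.
Qed.

(** Multiplying out (x^i + eta_i x^(k+i)) (x^j + eta_j x^(k+j)) reduces inner products to power sums
    of the evaluation points. *)
Lemma dotp_word (f g : 'rV[F]_k) :
  dotp (word f) (word g) = \sum_i g 0 i * \sum_j f 0 j *
    \sum_l (alpha l ^+ (i + j) + (eta i + eta j) * alpha l ^+ (k + (i + j))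
            + eta i * eta j * alpha l ^+ (2 * k + (i + j))).
Proof.
rewrite /dotp; under eq_bigr do rewrite !trs_wordE mulr_sumr.
rewrite exchange_big; apply: eq_bigr => i _; rewrite [in RHS]mulr_sumr.
under eq_bigr do rewrite mulr_suml.
rewrite exchange_big; apply: eq_bigr => j _; rewrite !mulr_sumr.
by apply: eq_bigr => l _; rewrite mul2n -addnn !exprD; ring.
Qed.

End Codes.

(** * Nondegeneracy of the Gram matrix and the LCD property *)

Section LCD.

Variables (F : finFieldType) (k n : nat) (eta : 'I_k -> F) (k_gt0 : (0 < k)%N).
Hypothesis le_2kn : (2 * k <= n)%N.
Hypothesis le_n3k : (n <= 3 * k)%N \/ k = 1%N /\ (2 < n)%N.
Hypothesis eta_neq0 : forall i, eta i != 0.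
Hypothesis etaD_neq0 : forall i j, eta i + eta j != 0.
Hypothesis eta0 : 1 + eta (Ordinal k_gt0) ^+ 2 != 0.

(* The Gram matrix of the twisted monomials, divided by [n]. *)
Let gram (i j : 'I_k) : F :=
  (i + j == 0)%N%:R + (eta i + eta j) * (k + (i + j) == n)%N%:R
  + eta i * eta j * (2 * k + (i + j) == n)%N%:R.

(** The other terms of row [i] drop out, leaving one product. Vanishing of entries is phrased
    through the index equations so that it is pure arithmetic. *)
Lemma gram_isolate (f : 'rV[F]_k) (i j : 'I_k) :
    \sum_j f 0 j * gram i j = 0 ->
    (forall j' : 'I_k, j' != j :> nat -> f 0 j' = 0 \/
      [/\ (i + j' == 0)%N = false, (k + (i + j') == n)%N = false
        & (2 * k + (i + j') == n)%N = false]) ->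
    gram i j != 0 -> f 0 j = 0.
Proof.
move=> rowi0 others gram_ij; move: rowi0; rewrite (bigD1 j) //= big1 ?addr0.
  by move/eqP; rewrite mulf_eq0 (negPf gram_ij) orbF => /eqP.
move=> j' /others[->|[c0 c1 c2]]; first by rewrite mul0r.
by rewrite /gram c0 c1 c2 !mulr0 !addr0 mulr0.
Qed.

(* [gram] is supported on the antidiagonals [i + j = 0], [n - k] and [n - 2k];
   once [f 0 0 = 0] is known, every other coordinate is alone in some row. *)
Lemma gram_nondegenerate (f : 'rV[F]_k) :
  (forall i, \sum_j f 0 j * gram i j = 0) -> f = 0.
Proof.
move=> fgram; pose i0 := Ordinal k_gt0.
have f0 : f 0 i0 = 0.
  (* For n = 2k the antidiagonals 0 and n - 2k coincide, and the corner entry is 1 + eta_0^2. *)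
  have [n2k|n_neq] := eqVneq n (2 * k)%N.
    apply: (gram_isolate (fgram i0)) => [j' /= nz_j'|].
      by right; have := ltn_ord j'; split; lia.
    rewrite /gram /=.
    have -> : (k + (0 + 0) == n)%N = false by lia.
    have -> : (2 * k + (0 + 0) == n)%N by lia.
    by rewrite mulr0 addr0 mulr1 -expr2.
  (* For 2k < n < 3k, column 0 is alone in row n - 2k; for n >= 3k it is alone in row 0, with entry
     1. *)
  have [lt_n3k|le_3kn] := ltnP n (3 * k).
    have lt_ik : (n - 2 * k < k)%N by lia.
    apply: (gram_isolate (fgram (Ordinal lt_ik))) => [j' /= nz_j'|].
      by right; have := ltn_ord j'; split; lia.
    rewrite /gram /=.
    have -> : (n - 2 * k + 0 == 0)%N = false by lia.
    have -> : (k + (n - 2 * k + 0) == n)%N = false by lia.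
    have -> : (2 * k + (n - 2 * k + 0) == n)%N by lia.
    by rewrite mulr0 !add0r mulr1 mulf_neq0.
  apply: (gram_isolate (fgram i0)) => [j' /= nz_j'|].
    by right; have := ltn_ord j'; split; lia.
  rewrite /gram /=.
  have -> : (k + (0 + 0) == n)%N = false by lia.
  have -> : (2 * k + (0 + 0) == n)%N = false by lia.
  by rewrite !mulr0 !addr0 oner_neq0.
apply/rowP => j; rewrite [RHS]mxE.
have [j0|j_neq0] := eqVneq (j : nat) 0%N.
  by rewrite -f0; congr (f 0 _); apply: val_inj.
have lt_jk := ltn_ord j.
have others0 (j' : 'I_k) : j' = 0 :> nat -> f 0 j' = 0.
  by move=> j'0; rewrite -f0; congr (f 0 _); apply: val_inj.
(* Pick the row meeting column [j] on antidiagonal n - 2k if j <= n - 2k, and on antidiagonal n - k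
   otherwise. *)
have [le_jn|lt_nj] := leqP (2 * k + j) n.
  have lt_ik : (n - 2 * k - j < k)%N by lia.
  apply: (gram_isolate (fgram (Ordinal lt_ik))) => [j' /= neq_j'|].
    have [/others0 ->|nz_j'] := eqVneq (j' : nat) 0%N; first by left.
    by right; have := ltn_ord j'; split; lia.
  rewrite /gram /=.
  have -> : (n - 2 * k - j + j == 0)%N = false by lia.
  have -> : (k + (n - 2 * k - j + j) == n)%N = false by lia.
  have -> : (2 * k + (n - 2 * k - j + j) == n)%N by lia.
  by rewrite mulr0 !add0r mulr1 mulf_neq0.
have lt_ik : (n - k - j < k)%N by lia.
apply: (gram_isolate (fgram (Ordinal lt_ik))) => [j' /= neq_j'|].
  have [/others0 ->|nz_j'] := eqVneq (j' : nat) 0%N; first by left.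
  by right; have := ltn_ord j'; split; lia.
rewrite /gram /=.
have -> : (n - k - j + j == 0)%N = false by lia.
have -> : (2 * k + (n - k - j + j) == n)%N = false by lia.
have -> : (k + (n - k - j + j) == n)%N by lia.
by rewrite mulr0 addr0 add0r mulr1.
Qed.

Lemma is_LCD_twist (alpha : 'I_n -> F) :
    (n%:R : F) != 0 ->
    (forall m, \sum_l alpha l ^+ m = if (n %| m)%N then n%:R else 0) ->
  is_LCD (TRS alpha (fun j : 'I_k => j.+1) (fun j : 'I_k => j) eta).
Proof.
move=> n_neq0 power_sum; apply/setP=> c; rewrite !inE.
apply/andP/eqP => [[/TRSP[f ->] /forall_inP dual_f]|->]; last first.
  split; first exact: mem0v.
  apply/forall_inP=> y _; rewrite /dotp big1 // => i _.
  by rewrite mxE mul0r.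
suff -> : f = 0 by rewrite linear0.
(* All exponents are at most 4k - 2 < 2n, so 0 and n are the only multiples of n that can occur. *)
have sumE m : (0 < n)%N -> (m < 2 * n)%N ->
    \sum_l alpha l ^+ m = n%:R * ((m == 0)%N%:R + (m == n)%:R).
  move=> n_gt0 lt_m; rewrite power_sum; have [->|m_neq0] := eqVneq m 0%N.
    by rewrite dvdn0 [0%N == n]eq_sym eqn0Ngt n_gt0 addr0 mulr1.
  have [->|m_neqn] := eqVneq m n; first by rewrite dvdnn add0r mulr1.
  rewrite addr0 mulr0; case: ifP => // /dvdnP[e Dm].
  by move: lt_m m_neq0 m_neqn; rewrite Dm; case: e {Dm} => [|[|e]]; nia.
apply: gram_nondegenerate => i; apply: (mulfI n_neq0); rewrite mulr0.
(* Orthogonality to the word of the unit message [i] is row [i] of the Gram system, up to the factor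
   n. *)
have memC : trs_word alpha (fun j : 'I_k => j.+1) id eta (delta_mx 0 i)
    \in TRS alpha (fun j : 'I_k => j.+1) id eta by apply/TRSP; eexists.
move/eqP: (dual_f _ memC) => dual_fi; rewrite -[RHS]dual_fi dotp_word.
rewrite [RHS](bigD1 i) //= [X in _ = _ + X]big1 => [|i' neq_i']; last first.
  by rewrite !mxE (negPf neq_i') andbF mul0r.
rewrite !mxE !eqxx mul1r addr0 mulr_sumr; apply: eq_bigr => j _.
have [lt_ik lt_jk] := (ltn_ord i, ltn_ord j).
rewrite !big_split -!mulr_sumr /= !sumE; try lia.
rewrite /gram.
have -> : (i + j == n)%N = false by lia.
have -> : (k + (i + j) == 0)%N = false by lia.
have -> : (2 * k + (i + j) == 0)%N = false by lia.
by rewrite addr0 !add0r; ring.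
Qed.

End LCD.

(** * From the subfield chain and the subgroup to the two criteria *)

Theorem corollary4p2
  (q q0 k n : nat) (F : finFieldType)
  (s : nat -> nat) (K : nat -> {set F})
  (G : {group {unit F}}) (alpha : 'I_n -> F) (eta : 'I_k -> F)
  (hq : odd_prime_power q) (hq0 : odd_prime_power q0) (hF : #|F| = q)
  (hk : (1 <= k)%N)
  (hs0 : s 0%N = 1%N)
  (hs : forall i, (i < k)%N -> (s i < s i.+1)%N)
  (hKfield : forall i, (i <= k)%N -> divring_closed (K i))
  (hKcard : forall i, (i <= k)%N -> #|K i| = (q0 ^ s i)%N)
  (hKchain : forall i, (i < k)%N -> K i \proper K i.+1)
  (hKtop : K k = [set: F])
  (hGsub : forall u, u \in G -> FinRing.uval u \in K 0%N)
  (hGcard : #|G| = n)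
  (halpha_inj : injective alpha)
  (halpha : [set alpha i | i : 'I_n] = [set FinRing.uval u | u in G])
  (heta : forall i : 'I_k, eta i \in K i.+1 :\: K i)
  (heta1 : 1 + eta (Ordinal hk) ^+ 2 != 0)
  (heta_neq0 : forall i : 'I_k, eta i != 0)
  (hkn : (2 * k <= n)%N)
  (hcond :
    [\/ (3 <= k)%N /\ (3 * k = n + 1)%N,
        (3 <= k)%N /\ (3 * k = n)%N,
        [/\ (3 <= k)%N, (n + 2 <= 3 * k)%N & (2 * k < n)%N] |
        ((3 <= k)%N /\ (2 * k = n)%N) \/ (k = 1%N /\ (2 < n)%N)]) :
  let C := TRS alpha (fun j : 'I_k => j.+1) (fun j : 'I_k => j) eta in
  is_LCD C /\ is_MDS k C.
Proof.
move=> C.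
have Kmono i j : (i <= j <= k)%N -> K i \subset K j.
  by apply: chain_subset => m /hKchain/proper_sub.
have alphaG l : exists2 u, u \in G & alpha l = FinRing.uval u.
  have : alpha l \in [set alpha i | i : 'I_n] by apply: imset_f.
  by rewrite halpha => /imsetP[u Gu ->]; exists u.
have two_neq0 : (2%:R : F) != 0.
  apply/eqP=> F2; case: hq; rewrite -hF => odd_F _.
  have pchar2 : 2 \in [pchar F] by rewrite inE /= F2 eqxx.
  have := natr_card_finField F; move/eqP; rewrite -(dvdn_pcharf pchar2) dvdn2.
  by rewrite odd_F.
(* Otherwise [eta j] equals [- eta i], which lies in [K i.+1] and hence in [K j]. *)
have etaD_lt (i j : 'I_k) : (i < j)%N -> eta i + eta j != 0.
  move=> lt_ij; apply: contraTneq (heta j) => /eqP.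
  rewrite addrC addr_eq0 => /eqP ->; rewrite inE negb_and negbK.
  have le_jk : (j <= k)%N by apply: ltnW.
  have := heta i; rewrite inE => /andP[_ Ki].
  have {}Ki : eta i \in K j by apply: (subsetP (Kmono i.+1 j _)) Ki; rewrite lt_ij.
  have [K1 KB _] := hKfield j le_jk.
  by rewrite -sub0r KB // -(subrr 1) KB.
(* The diagonal case 2 eta_i != 0 is where odd characteristic enters. *)
have etaD i j : eta i + eta j != 0.
  case: (ltngtP i j) => [/etaD_lt //|/etaD_lt|/val_inj ->]; first by rewrite addrC.
  by rewrite -mulr2n -mulr_natl mulf_neq0.
split.
  apply: (is_LCD_twist (k_gt0 := hk)) => //.
  (* Cases (A) to (D) all imply n <= 3k; case (E) is the other alternative. *)
  - by case: hcond => [|||[]] => -[]; lia.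
  - by rewrite -hGcard natr_card_unit_subgroup_neq0.
  move=> m; rewrite -[in RHS]hGcard -sum_unit_subgroup_expr.
  rewrite -(big_imset (h := val) (fun x => x ^+ m)) /=; last by move=> u v _ _; apply: val_inj.
  rewrite -halpha big_imset //=; last by move=> i j _ _; apply: halpha_inj.
apply: is_MDS_twist_vanish => //; first by apply/andP; split=> //; lia.
move=> f b b_inj b_alpha; apply: (twist_vanish hKfield) => //.
  by move=> i /hKchain/proper_sub.
move=> i; have /codomP[l ->] := b_alpha i.
by have [u Gu ->] := alphaG l; apply: hGsub.
Qed.
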